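(* Let $\mathbf A_k,\mathbf B_k\in\mathbb C^{NK\times NK}$ ($k=1,\dots,K$) be the matrices defined in the context, and for nonzero $\bar{\mathbf f}\in\mathbb C^{NK}$ let $$\lambda_{\sf BS}(\bar{\mathbf f})=\prod_{k=1}^K\frac{\bar{\mathbf f}^{\sf H}\mathbf A_k\bar{\mathbf f}}{\bar{\mathbf f}^{\sf H}\mathbf B_k\bar{\mathbf f}},\qquad \mathcal L_{\sf BS}(\bar{\mathbf f})=\log_2\lambda_{\sf BS}(\bar{\mathbf f})=\sum_{k=1}^K\log_2\left(\frac{\bar{\mathbf f}^{\sf H}\mathbf A_k\bar{\mathbf f}}{\bar{\mathbf f}^{\sf H}\mathbf B_k\bar{\mathbf f}}\right).$$ Let $\lambda_{{\sf BS},{\sf num}}$ and $\lambda_{{\sf BS},{\sf den}}$ be any scalar functions of $\bar{\mathbf f}$ with $\lambda_{\sf BS}(\bar{\mathbf f})=\lambda_{{\sf BS},{\sf num}}(\bar{\mathbf f})/\lambda_{{\sf BS},{\sf den}}(\bar{\mathbf f})$, and set $$\bar{\mathbf A}(\bar{\mathbf f})=\lambda_{{\sf BS},{\sf num}}(\bar{\mathbf f})\sum_{k=1}^K\frac{\mathbf A_k}{\bar{\mathbf f}^{\sf H}\mathbf A_k\bar{\mathbf f}},\qquad \bar{\mathbf B}(\bar{\mathbf f})=\lambda_{{\sf BS},{\sf den}}(\bar{\mathbf f})\sum_{k=1}^K\frac{\mathbf B_k}{\bar{\mathbf f}^{\sf H}\mathbf B_k\bar{\mathbf f}}.$$ Then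 the stationarity condition $\partial\mathcal L_{\sf BS}(\bar{\mathbf f})/\partial\bar{\mathbf f}^{\sf H}=\mathbf 0$ of the problem of maximizing $\mathcal L_{\sf BS}$ over $\bar{\mathbf f}$ is satisfied at $\bar{\mathbf f}$ if $$\bar{\mathbf B}^{-1}(\bar{\mathbf f})\,\bar{\mathbf A}(\bar{\mathbf f})\,\bar{\mathbf f}=\lambda_{\sf BS}(\bar{\mathbf f})\,\bar{\mathbf f}.$$
   Context: Let $N,K,L,M\ge1$ be integers and $\sigma^2>0$, $P>0$. For $k=1,\dots,K$ and $\ell=1,\dots,L$ let $\hat{\mathbf H}^{\sf r}_{k,\ell}\in\mathbb C^{N\times M}$ be given matrices (channel estimates), $\mathbf R^{\sf e}_{k,\ell}\in\mathbb C^{NM\times NM}$ given Hermitian positive semidefinite matrices (error covariances), and $\boldsymbol\phi_\ell\in\mathbb C^M$ given vectors with unit-modulus entries (fixed phase shifts). Put $\hat{\mathbf h}_k=\sum_{\ell=1}^L\hat{\mathbf H}^{\sf r}_{k,\ell}\boldsymbol\phi_\ell\in\mathbb C^N$ and $\boldsymbol\Xi_k=\sum_{\ell=1}^L(\boldsymbol\phi_\ell^{\sf T}\otimes\mathbf I_N)\mathbf R^{\sf e}_{k,\ell}(\boldsymbol\phi_\ell^{\sf T}\otimes\mathbf I_N)^{\sf H}\in\mathbb C^{N\times N}$. Define $$\mathbf A_k=\mathrm{blkdiag}\left(\hat{\mathbf h}_k\hat{\mathbf h}_k^{\sf H}+\boldsymbol\Xi_k,\dots,\hat{\mathbf h}_k\hat{\mathbf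 h}_k^{\sf H}+\boldsymbol\Xi_k\right)+\frac{\sigma^2}{P}\mathbf I_{NK}\quad(K\text{ identical blocks}),$$ $$\mathbf B_k=\mathbf A_k-\mathrm{blkdiag}\left(\mathbf 0,\dots,\hat{\mathbf h}_k\hat{\mathbf h}_k^{\sf H},\dots,\mathbf 0\right),$$ where the only nonzero $N\times N$ block in the last matrix is the $k$-th of $K$ diagonal blocks. The variable $\bar{\mathbf f}=[\mathbf f_1^{\sf T},\dots,\mathbf f_K^{\sf T}]^{\sf T}\in\mathbb C^{NK}$ is the stacked precoding vector. For a real-valued function of a complex vector, $\partial/\partial\bar{\mathbf f}^{\sf H}$ denotes the (Wirtinger) gradient with respect to the conjugate variable; its vanishing is equivalent to vanishing of the real gradient in real and imaginary parts (a constant scaling convention is immaterial). *)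

(* Defs.v *)
(* The reals are an arbitrary realType R; the complex numbers are R[i]. *)
From mathcomp Require Import all_boot all_order all_algebra.
From mathcomp Require Import all_classical all_reals all_analysis.
From mathcomp Require Import complex mxtens.

Set Implicit Arguments.
Unset Strict Implicit.
Unset Printing Implicit Defensive.

Import Order.TTheory GRing.Theory Num.Theory.
Import numFieldNormedType.Exports.

Local Open Scope ring_scope.
Local Open Scope complex_scope.
Local Open Scope sesquilinear_scope.

(* The order of R[i] is partial: 0 <= z says that z is real and nonnegative. *)
Definition hermitian_psd (R : realType) (n : nat) (A : 'M[R[i]]_n) : Prop :=
  A ^t* = A /\ forall x : 'cV[R[i]]_n, 0 <= (x ^t* *m A *m x) 0 0.

Definition quad (R : realType) (n : nat) (A : 'M[R[i]]_n) (x : 'cV[R[i]]_n) :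
  R[i] := (x ^t* *m A *m x) 0 0.

Definition log2 (R : realType) (x : R) : R := ln x / ln 2.

(* dRe and dIm are the partial derivatives of g with respect to the real and
   imaginary parts of the j-th coordinate. *)
Section Wirtinger.
Variables (R : realType) (n : nat).
Implicit Types (g : 'cV[R[i]]_n -> R) (f : 'cV[R[i]]_n) (j : 'I_n).

Definition along g f (d : 'cV[R[i]]_n) : R -> R :=
  fun t => g (f + t%:C *: d).

Definition axis_re j : 'cV[R[i]]_n := delta_mx j 0.
Definition axis_im j : 'cV[R[i]]_n := (0 +i* 1) *: delta_mx j 0.

Definition has_partials g f : Prop :=
  forall j, derivable (along g f (axis_re j)) 0 1 /\
            derivable (along g f (axis_im j)) 0 1.

Definition dRe g f j : R := derive1 (along g f (axis_re j)) 0.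
Definition dIm g f j : R := derive1 (along g f (axis_im j)) 0.

(* d/d(conj z) = (d/dx + i d/dy) / 2 in each coordinate z = x + i y. *)
Definition wirtinger_grad g f : 'cV[R[i]]_n :=
  \col_j (2^-1 * (dRe g f j +i* dIm g f j)).

(* derive1 is a total operator, so the existence of the partial derivatives is
   part of the condition. *)
Definition stationary g f : Prop :=
  has_partials g f /\ wirtinger_grad g f = 0.

End Wirtinger.

Section Precoding.
Variables (R : realType) (N K L M : nat).
Variables (sigma P : R).
Variables (Hr : 'I_K -> 'I_L -> 'M[R[i]]_(N, M)).
(* The N M coordinates are grouped in M consecutive blocks of length N, as in
   the column-stacking vectorization of an N x M matrix. *)
Variables (Rerr : 'I_K -> 'I_L -> 'M[R[i]]_(M * N)).
Variables (phi : 'I_L -> 'cV[R[i]]_M).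

Definition hhat (k : 'I_K) : 'cV[R[i]]_N := \sum_(l < L) Hr k l *m phi l.

(* The cast turns the row dimension 1 * N of the Kronecker product into N. *)
Definition phi_kron (l : 'I_L) : 'M[R[i]]_(N, M * N) :=
  castmx (mul1n N, erefl) ((phi l)^T *t (1%:M : 'M[R[i]]_N)).

Definition Xi (k : 'I_K) : 'M[R[i]]_N :=
  \sum_(l < L) phi_kron l *m Rerr k l *m (phi_kron l) ^t*.

(* \mxdiag indexes its rows by 'I_(\sum_(b < K) N), a set of size N K. *)
Definition Amx (k : 'I_K) : 'M[R[i]]_(\sum_(b < K) N) :=
  \mxdiag_(b < K) (hhat k *m (hhat k) ^t* + Xi k)
  + ((sigma ^+ 2 / P)%:C)%:M.

Definition Bmx (k : 'I_K) : 'M[R[i]]_(\sum_(b < K) N) :=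
  Amx k - \mxdiag_(b < K) (if b == k then hhat k *m (hhat k) ^t* else 0).

Definition lambda_BS (f : 'cV[R[i]]_(\sum_(b < K) N)) : R[i] :=
  \prod_(k < K) (quad (Amx k) f / quad (Bmx k) f).

(* For nonzero f the forms are positive reals (Amx k and Bmx k are Hermitian
   positive definite), hence so is lambda_BS f; complex.Re only retypes it. *)
Definition L_BS (f : 'cV[R[i]]_(\sum_(b < K) N)) : R :=
  log2 (complex.Re (lambda_BS f)).

Variables (lnum lden : 'cV[R[i]]_(\sum_(b < K) N) -> R[i]).

Definition Abar (f : 'cV[R[i]]_(\sum_(b < K) N)) :
    'M[R[i]]_(\sum_(b < K) N) :=
  lnum f *: \sum_(k < K) (quad (Amx k) f)^-1 *: Amx k.

Definition Bbar (f : 'cV[R[i]]_(\sum_(b < K) N)) :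
    'M[R[i]]_(\sum_(b < K) N) :=
  lden f *: \sum_(k < K) (quad (Bmx k) f)^-1 *: Bmx k.

End Precoding.

(* Main.v *)
(* The matrices A_k and B_k are Hermitian positive definite, so every quadratic
   form f^H A_k f, f^H B_k f is a positive real and Bbar(f) is invertible.  The
   derivative of L_BS at f in a direction d is
     (2 / ln 2) Re (d^H (S_A - S_B) f),
   S_X = sum_k X_k / (f^H X_k f).  Multiplying the eigenvalue equation by
   Bbar(f) gives lnum S_A f = lambda lden S_B f, and lambda lden = lnum != 0, so
   S_A f = S_B f and all directional derivatives vanish. *)
Require Import Defs.
From mathcomp Require Import all_boot all_order all_algebra.
From mathcomp Require Import all_classical all_reals all_analysis.
From mathcomp Require Import complex mxtens ring.
Import Order.TTheory GRing.Theory Num.Theory.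
Import numFieldNormedType.Exports.
Local Open Scope ring_scope.
Local Open Scope complex_scope.
Local Open Scope sesquilinear_scope.

(** * Algebra of the conjugate transpose *)

Lemma adjmxM (C : numClosedFieldType) (m n p : nat)
    (A : 'M[C]_(m, n)) (B : 'M[C]_(n, p)) :
  (A *m B) ^t* = B ^t* *m A ^t*.
Proof. by rewrite trmx_mul map_mxM. Qed.

Lemma adjmxD (C : numClosedFieldType) (m n : nat) (A B : 'M[C]_(m, n)) :
  (A + B) ^t* = A ^t* + B ^t*.
Proof. by rewrite linearD map_mxD. Qed.

Lemma adjmxZ (C : numClosedFieldType) (m n : nat) (c : C) (A : 'M[C]_(m, n)) :
  (c *: A) ^t* = c^* *: A ^t*.
Proof. by rewrite linearZ map_mxZ. Qed.

(** * Hermitian forms: positivity, reality, invertibility *)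

Section Forms.
Context {R : realType}.
Set Implicit Arguments.
Unset Strict Implicit.
Implicit Types (n m : nat).

Definition hermitian_pd n (A : 'M[R[i]]_n) : Prop :=
  A ^t* = A /\ forall x : 'cV[R[i]]_n, x != 0 -> 0 < quad A x.

Lemma quadD n (A B : 'M[R[i]]_n) x : quad (A + B) x = quad A x + quad B x.
Proof. by rewrite /quad mulmxDr mulmxDl mxE. Qed.

Lemma quadZ n (c : R[i]) (A : 'M[R[i]]_n) x : quad (c *: A) x = c * quad A x.
Proof. by rewrite /quad -scalemxAr -scalemxAl mxE. Qed.

Lemma quad_sum n (I : finType) (A : I -> 'M[R[i]]_n) x :
  quad (\sum_k A k) x = \sum_k quad (A k) x.
Proof. by rewrite /quad mulmx_sumr mulmx_suml summxE. Qed.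

Lemma quad_scalar n (c : R[i]) (x : 'cV[R[i]]_n) :
  quad c%:M x = c * \sum_i `|x i 0| ^+ 2.
Proof.
rewrite -scalemx1 quadZ /quad mulmx1 mxE; congr (_ * _).
by apply: eq_bigr => i _; rewrite !mxE mulrC -normCK.
Qed.

Lemma quad_scalar_gt0 n (c : R[i]) (x : 'cV[R[i]]_n) :
  0 < c -> x != 0 -> 0 < quad c%:M x.
Proof.
move=> c_gt0 x_neq0; rewrite quad_scalar mulr_gt0 //.
have sq_ge0 i : i \in predT -> 0 <= `|x i 0| ^+ 2 by rewrite exprn_ge0.
rewrite lt0r sumr_ge0 ?andbT; last by move=> i _; rewrite sq_ge0.
apply: contraNneq x_neq0 => s0.
have /(_ _ _)/eqP x0 := psumr_eq0P sq_ge0 s0.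
apply/eqP/matrixP => i j; rewrite ord1 mxE.
by apply/eqP; rewrite -normr_eq0 -sqrf_eq0 x0.
Qed.

Lemma hermitian_psd0 n : hermitian_psd (0 : 'M[R[i]]_n).
Proof.
split; first by rewrite linear0 map_mx0.
by move=> x; rewrite mulmx0 mul0mx mxE.
Qed.

Lemma hermitian_psdD n (A B : 'M[R[i]]_n) :
  hermitian_psd A -> hermitian_psd B -> hermitian_psd (A + B).
Proof.
move=> [hA pA] [hB pB]; split; first by rewrite adjmxD hA hB.
by move=> x; rewrite mulmxDr mulmxDl mxE addr_ge0.
Qed.

Lemma hermitian_psd_sum n (I : finType) (A : I -> 'M[R[i]]_n) :
  (forall k, hermitian_psd (A k)) -> hermitian_psd (\sum_k A k).
Proof.
move=> hA; elim: (index_enum I) => [|k r IH].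
  by rewrite big_nil; exact: hermitian_psd0.
by rewrite big_cons; apply: hermitian_psdD; [exact: hA | exact: IH].
Qed.

Lemma hermitian_psd_congr m n (Q : 'M[R[i]]_(m, n)) (A : 'M[R[i]]_n) :
  hermitian_psd A -> hermitian_psd (Q *m A *m Q ^t*).
Proof.
move=> [hA pA]; split; first by rewrite !adjmxM trmxCK hA mulmxA.
by move=> x; have := pA (Q ^t* *m x); rewrite adjmxM trmxCK !mulmxA.
Qed.

(** The form at [x] is the squared modulus of the scalar [h ^t* *m x]. *)
Lemma hermitian_psd_rank1 n (h : 'cV[R[i]]_n) : hermitian_psd (h *m h ^t*).
Proof.
split; first by rewrite adjmxM trmxCK.
move=> x; rewrite mulmxA -mulmxA -{1}[h]trmxCK -adjmxM mxE big_ord1 !mxE mulrC.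
exact: mul_conjC_ge0.
Qed.

(** Cutting [x] into blocks splits the form into the sum of the forms of the [D k]. *)
Lemma hermitian_psd_mxdiag (K n : nat) (D : 'I_K -> 'M[R[i]]_n) :
  (forall k, hermitian_psd (D k)) -> hermitian_psd (\mxdiag_(k < K) D k).
Proof.
move=> hD; split.
  apply/matrixP => i j; rewrite tr_mxdiag !mxE.
  case: eqP => _; last by rewrite mxE conjC0.
  (* All blocks have the same size, so the size adjustment [conform_mx] is the identity. *)
  have [hk _] := hD (tagnat.sig1 i); by rewrite !conform_mx_id mxE -[in RHS]hk !mxE.
move=> x; rewrite -[x]submxcolK.
have -> : (\mxcol_k submxcol x k) ^t* = \mxrow_(k < K) (submxcol x k) ^t*.
  by apply/matrixP => i j; rewrite !mxE.
rewrite mul_mxrow_mxdiag.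
rewrite mul_mxrow_mxcol summxE sumr_ge0 // => k _.
by have [_] := hD k; apply.
Qed.

(** Applied with [c] the noise level [sigma ^+ 2 / P], the source of all strict positivity below. *)
Lemma hermitian_psd_shift n (c : R) (A : 'M[R[i]]_n) :
  hermitian_psd A -> 0 < c -> hermitian_pd (A + c%:C%:M).
Proof.
move=> [hA pA] c_gt0; split.
  rewrite adjmxD hA tr_scalar_mx map_scalar_mx /=; congr (_ + _%:M).
  by apply/CrealP; rewrite complex_real.
move=> x x_neq0; rewrite quadD ltr_wpDl ?pA //.
by apply: quad_scalar_gt0; rewrite ?ltcR.
Qed.

(** The 1 x 1 matrix [x ^t* *m A *m x] equals its adjoint, so its entry is real. This moves values
    from [R[i]] to [R], where [ln] and derivatives live. *)
Lemma hermitian_quadE n (A : 'M[R[i]]_n) x :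
  A ^t* = A -> quad A x = (complex.Re (quad A x))%:C.
Proof.
move=> hA; apply/esym/RRe_real/CrealP.
have : (x ^t* *m A *m x) ^t* = x ^t* *m A *m x.
  by rewrite !adjmxM trmxCK hA mulmxA.
by move=> /matrixP/(_ 0 0); rewrite mxE mxE.
Qed.

Lemma hermitian_pd_Re_gt0 n (A : 'M[R[i]]_n) x :
  hermitian_pd A -> x != 0 -> 0 < complex.Re (quad A x).
Proof. by move=> [hA pA] /pA; rewrite hermitian_quadE // ltcR. Qed.

Lemma quad_gt0_unitmx n (A : 'M[R[i]]_n) :
  (forall x, x != 0 -> 0 < quad A x) -> A \in unitmx.
Proof.
(* A nonzero row [v] with [v *m A = 0] would make the form vanish at [v ^t*]. *)
move=> pA; rewrite unitmxE unitfE; apply/det0P => -[v v_neq0 vA0].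
have /pA : v ^t* != 0.
  by apply: contraNneq v_neq0 => v0; rewrite -[v]trmxCK v0 linear0 map_mx0.
by rewrite /quad trmxCK vA0 mul0mx mxE ltxx.
Qed.

(** * Derivatives along real lines *)

Lemma is_derive_along_quad n (A : 'M[R[i]]_n) (f d : 'cV[R[i]]_n) :
  A ^t* = A ->
  is_derive (0 : R) 1 (fun t : R => complex.Re (quad A (f + t%:C *: d)))
    (2 * complex.Re ((d ^t* *m A *m f) 0 0)).
Proof.
move=> hA.
set u := (d ^t* *m A *m f) 0 0.
have uC : (f ^t* *m A *m d) 0 0 = u^*%R.
  have -> : f ^t* *m A *m d = (d ^t* *m A *m f) ^t*.
    by rewrite !adjmxM trmxCK hA mulmxA.
  by rewrite 2!mxE.
(* Along the line the form is a quadratic polynomial in [t]. As [t] is real, the two cross terms are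
   conjugate, with sum [t * (2 * complex.Re u)]. *)
have E : (fun t : R => complex.Re (quad A (f + t%:C *: d))) =
  (fun t : R => complex.Re (quad A f) + t * (2 * complex.Re u)
     + t * t * complex.Re (quad A d)).
  apply/funext => t.
  have tJ : (t%:C)^*%R = t%:C by apply/CrealP; rewrite complex_real.
  have -> : quad A (f + t%:C *: d) =
     quad A f + t%:C * (u + u^*%R) + t%:C * t%:C * quad A d.
    rewrite /quad adjmxD adjmxZ tJ !mulmxDl !mulmxDr.
    rewrite -?scalemxAl -?scalemxAr -?scalemxAl -uC /u.
    (* Generalized so that [mxE] does not expand the matrix products into sums. *)
    move: (f ^t* *m A *m f) (f ^t* *m A *m d) (d ^t* *m A *m f) => P1 P2 P3.
    by rewrite !mxE; ring.
  case: (u) (quad A f) (quad A d) => [u1 u2] [p1 p2] [q1 q2] /=.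
  ring.
rewrite E; apply: is_derive_eq.
rewrite /GRing.scale /=; ring.
Qed.

(** The product rule with the whole product factored out, so that the derivative of [ln] cancels it
    later. *)
Lemma is_derive_prod_log (I : Type) (r : seq I) (g : I -> R -> R) (dg : I -> R)
    (x : R) :
  (forall k, is_derive x 1 (g k) (dg k)) -> (forall k, g k x != 0) ->
  is_derive x 1 (fun t => \prod_(k <- r) g k t)
    (\prod_(k <- r) g k x * \sum_(k <- r) dg k / g k x).
Proof.
move=> hg g0; elim: r => [|k r IH].
  rewrite !big_nil mulr0.
  under eq_fun do rewrite big_nil.
  exact: is_derive_cst.
under eq_fun do rewrite big_cons.
rewrite !big_cons; apply: is_derive_eq.
rewrite /= /GRing.scale /=. field. exact: g0.
Qed.


(** * Logarithms of products of ratios of positive definite forms *)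

Section ProductOfRatios.
Variables (n : nat) (I : finType) (A B : I -> 'M[R[i]]_n).
Implicit Types (f d x : 'cV[R[i]]_n).
Hypotheses (pdA : forall k, hermitian_pd (A k)).
Hypotheses (pdB : forall k, hermitian_pd (B k)).

(** The [S_X] of the overview; [Abar] and [Bbar] are scalar multiples of it. *)
Definition normalized_sum (X : I -> 'M[R[i]]_n) f : 'M[R[i]]_n :=
  \sum_k (quad (X k) f)^-1 *: X k.

Definition log_ratio f : R :=
  log2 (complex.Re (\prod_k (quad (A k) f / quad (B k) f))).

(** Not a property of [complex.Re] in general: it holds because every form is real. *)
Lemma Re_prod_ratio f :
  complex.Re (\prod_k (quad (A k) f / quad (B k) f)) =
  \prod_k (complex.Re (quad (A k) f) / complex.Re (quad (B k) f)).
Proof.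
under eq_bigr => k _.
  rewrite (hermitian_quadE f (pdA k).1) (hermitian_quadE f (pdB k).1).
  rewrite -fmorphV -rmorphM.
  over.
by rewrite -rmorph_prod.
Qed.

(** Nonemptiness of [I] supplies one strictly positive term. This yields the invertibility of
    [Bbar]. *)
Lemma normalized_sum_gt0 (X : I -> 'M[R[i]]_n) f x :
    (forall k, hermitian_pd (X k)) -> (0 < #|I|)%N -> f != 0 -> x != 0 ->
  0 < quad (normalized_sum X f) x.
Proof.
move=> pdX /card_gt0P[k0 _] f0 x0; rewrite quad_sum.
have gt0 k : 0 < quad ((quad (X k) f)^-1 *: X k) x.
  by rewrite quadZ mulr_gt0 ?invr_gt0 //; have [_] := pdX k; apply.
rewrite (bigD1 k0) //= ltr_pwDl // sumr_ge0 // => k _; exact: ltW.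
Qed.

Lemma Re_normalized_sum (X : I -> 'M[R[i]]_n) f d :
    (forall k, hermitian_pd (X k)) ->
  complex.Re ((d ^t* *m normalized_sum X f *m f) 0 0) =
  \sum_k complex.Re ((d ^t* *m X k *m f) 0 0) / complex.Re (quad (X k) f).
Proof.
move=> pdX; rewrite mulmx_sumr mulmx_suml summxE.
have -> : complex.Re (\sum_k (d ^t* *m ((quad (X k) f)^-1 *: X k) *m f) 0 0) =
  \sum_k complex.Re ((d ^t* *m ((quad (X k) f)^-1 *: X k) *m f) 0 0).
  exact: (raddf_sum (@complex.Re R)).
apply: eq_bigr => k _.
rewrite -scalemxAr -scalemxAl mxE (hermitian_quadE f (pdX k).1) -fmorphV.
by case: (_ 0 0) => a b /=; rewrite mul0r subr0 mulrC.
Qed.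

Lemma is_derive_log_ratio f d : f != 0 ->
  is_derive (0 : R) 1 (along log_ratio f d)
    (2 / ln 2 * (complex.Re ((d ^t* *m normalized_sum A f *m f) 0 0)
               - complex.Re ((d ^t* *m normalized_sum B f *m f) 0 0))).
Proof.
move=> f_neq0.
pose a k t := complex.Re (quad (A k) (f + t%:C *: d)).
pose b k t := complex.Re (quad (B k) (f + t%:C *: d)).
pose da k := 2 * complex.Re ((d ^t* *m A k *m f) 0 0).
pose db k := 2 * complex.Re ((d ^t* *m B k *m f) 0 0).
have f00 : f + (0 : R)%:C *: d = f by rewrite scale0r addr0.
have a_gt0 k : 0 < a k 0 by rewrite /a f00 hermitian_pd_Re_gt0.
have b_gt0 k : 0 < b k 0 by rewrite /b f00 hermitian_pd_Re_gt0.
have ha k : is_derive (0 : R) 1 (a k) (da k).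
  exact: is_derive_along_quad (pdA k).1.
have hb k : is_derive (0 : R) 1 (b k) (db k).
  exact: is_derive_along_quad (pdB k).1.
(* Ratio times logarithmic derivative: the ratio cancels in the sum given by
   [is_derive_prod_log]. *)
have hr k : is_derive (0 : R) 1 (fun t => a k t / b k t)
    ((a k 0 / b k 0) * (da k / a k 0 - db k / b k 0)).
  have hbV := is_deriveV (lt0r_neq0 (b_gt0 k)) (hb k).
  apply: (is_derive_eq (is_deriveM (ha k) hbV)).
  have := lt0r_neq0 (a_gt0 k); have := lt0r_neq0 (b_gt0 k).
  rewrite /GRing.scale /=; move: (a k 0) (b k 0) => x y y0 x0.
  by field; rewrite x0 y0.
have r_neq0 k : a k 0 / b k 0 != 0 by rewrite lt0r_neq0 ?divr_gt0.
have hp := is_derive_prod_log (index_enum I) hr r_neq0.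
have p_gt0 : 0 < \prod_k (a k 0 / b k 0).
  by apply: prodr_gt0 => k _; rewrite divr_gt0.
have hl := is_derive1_comp (is_derive1_ln p_gt0) hp.
have -> : along log_ratio f d =
    (ln 2)^-1 \*: (@ln R \o (fun t => \prod_k (a k t / b k t))).
  by apply/funext => t; rewrite /along /log_ratio /log2 Re_prod_ratio /= mulrC.
apply: is_derive_eq.
(* The derivative of [ln] contributes the inverse of the product, which cancels here. *)
rewrite (mulKf (lt0r_neq0 p_gt0)) (Re_normalized_sum f d pdA).
rewrite (Re_normalized_sum f d pdB) -sumrB [2 / _]mulrC -mulrA; congr (_ * _).
rewrite mulr_sumr; apply: eq_bigr => k _.
rewrite [X in X / _]mulrC mulfK // /da /db /a /b f00.
by rewrite mulrBr !mulrA.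
Qed.

Lemma stationary_log_ratio f : f != 0 ->
  normalized_sum A f *m f = normalized_sum B f *m f ->
  stationary log_ratio f.
Proof.
move=> f_neq0 eqAB.
(* Every direction is treated at once; [axis_re j] and [axis_im j] are instances. *)
have h d : is_derive (0 : R) 1 (along log_ratio f d) 0.
  apply: (is_derive_eq (is_derive_log_ratio d f_neq0)).
  by rewrite -!mulmxA eqAB subrr mulr0.
split=> [j|].
  by split; apply: (@ex_derive _ _ _ _ _ _ _ (h _)).
have D d : derive1 (along log_ratio f d) 0 = 0.
  by rewrite derive1E; exact: (@derive_val _ _ _ _ _ _ _ (h d)).
have re0 j : dRe log_ratio f j = 0 by exact: D.
have im0 j : dIm log_ratio f j = 0 by exact: D.
apply/matrixP => j j'.
by rewrite [LHS]mxE re0 im0 [RHS]mxE; exact: mulr0.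
Qed.

End ProductOfRatios.

End Forms.

Section Precoding.
Variables (R : realType) (N K L M : nat) (sigma P : R).
Variables (Hr : 'I_K -> 'I_L -> 'M[R[i]]_(N, M)).
Variables (Rerr : 'I_K -> 'I_L -> 'M[R[i]]_(M * N)).
Variables (phi : 'I_L -> 'cV[R[i]]_M).
Hypotheses (noise_gt0 : 0 < sigma ^+ 2 / P).
Hypotheses (psdRerr : forall k l, hermitian_psd (Rerr k l)).

Lemma hermitian_psd_Xi k : hermitian_psd (Xi Rerr phi k).
Proof. by apply: hermitian_psd_sum => l; exact: hermitian_psd_congr. Qed.

Lemma hermitian_pd_Amx k : hermitian_pd (Amx sigma P Hr Rerr phi k).
Proof.
apply: hermitian_psd_shift => //; apply: hermitian_psd_mxdiag => b.
apply: hermitian_psdD; first exact: hermitian_psd_rank1.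
exact: hermitian_psd_Xi.
Qed.

(** The subtraction removes the rank-one term from block [k], leaving [Xi] there and the other
    blocks intact; the noise shift stays outside. *)
Lemma hermitian_pd_Bmx k : hermitian_pd (Bmx sigma P Hr Rerr phi k).
Proof.
rewrite /Bmx /Amx addrAC -mxdiagB.
apply: hermitian_psd_shift => //; apply: hermitian_psd_mxdiag => b.
case: (b == k).
  by rewrite addrAC subrr add0r; exact: hermitian_psd_Xi.
rewrite subr0; apply: hermitian_psdD; first exact: hermitian_psd_rank1.
exact: hermitian_psd_Xi.
Qed.

End Precoding.

Theorem lemma1 (R : realType) (N K L M : nat)
  (hN : (1 <= N)%N) (hK : (1 <= K)%N) (hL : (1 <= L)%N) (hM : (1 <= M)%N)
  (sigma P : R) (hsigma : 0 < sigma ^+ 2) (hP : 0 < P)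
  (Hr : 'I_K -> 'I_L -> 'M[R[i]]_(N, M))
  (Rerr : 'I_K -> 'I_L -> 'M[R[i]]_(M * N))
  (hRerr : forall k l, hermitian_psd (Rerr k l))
  (phi : 'I_L -> 'cV[R[i]]_M)
  (hphi : forall l m, `|phi l m 0| = 1)
  (lnum lden : 'cV[R[i]]_(\sum_(b < K) N) -> R[i])
  (hlambda : forall f : 'cV[R[i]]_(\sum_(b < K) N), f != 0 ->
     lambda_BS sigma P Hr Rerr phi f = lnum f / lden f)
  (f : 'cV[R[i]]_(\sum_(b < K) N)) (hf : f != 0) :
  invmx (Bbar sigma P Hr Rerr phi lden f)
    *m Abar sigma P Hr Rerr phi lnum f *m f
  = lambda_BS sigma P Hr Rerr phi f *: f ->
  stationary (L_BS sigma P Hr Rerr phi) f.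
Proof.
move=> eigen.
have noise_gt0 : 0 < sigma ^+ 2 / P by rewrite divr_gt0.
set A := Amx sigma P Hr Rerr phi; set B := Bmx sigma P Hr Rerr phi.
have pdA k : hermitian_pd (A k) by exact: hermitian_pd_Amx.
have pdB k : hermitian_pd (B k) by exact: hermitian_pd_Bmx.
have lambda_gt0 : 0 < lambda_BS sigma P Hr Rerr phi f.
  apply: prodr_gt0 => k _; have [_ A_gt0] := pdA k; have [_ B_gt0] := pdB k.
  by rewrite divr_gt0 ?A_gt0 ?B_gt0.
have lambdaE := hlambda f hf.
have num_neq0 : lnum f != 0.
  by apply: contraTneq lambda_gt0 => e; rewrite lambdaE e mul0r ltxx.
(* Division by zero returns zero, which would contradict [lambda_gt0]. *)
have den_neq0 : lden f != 0.
  by apply: contraTneq lambda_gt0 => e; rewrite lambdaE e invr0 mulr0 ltxx.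
(* Needed to cancel [invmx], which returns a singular matrix unchanged. *)
have Bbar_unit : Bbar sigma P Hr Rerr phi lden f \in unitmx.
  rewrite unitmxZ ?unitfE //.
  apply: quad_gt0_unitmx => x x_neq0.
  by apply: normalized_sum_gt0; rewrite ?card_ord.
(* [L_BS] is convertible to [log_ratio A B]. *)
apply: (stationary_log_ratio pdA pdB hf).
apply: (scalerI num_neq0); rewrite !scalemxAl.
move: (congr1 (mulmx (Bbar sigma P Hr Rerr phi lden f)) eigen).
rewrite -mulmxA (mulKVmx Bbar_unit) => ->.
(* Uses [lambda * lden = lnum] at [f]. *)
by rewrite -scalemxAr -!scalemxAl scalerA lambdaE divfK.
Qed.
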